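(* Let $X$ be a finite set. Given the Dowker complex and the total weight of a relation between $X$ and a finite set, the relation can be reconstructed up to a bijection on the second set. That is: let $Y,Y'$ be finite sets and let $R\subseteq X\times Y$, $R'\subseteq X\times Y'$ be relations such that $D(X,Y,R)=D(X,Y',R')$ and the total weights $t$ of $R$ and $t'$ of $R'$ agree on this complex. Then there is a bijection $g:Y\to Y'$ such that for all $x\in X$ and $y\in Y$, $(x,y)\in R$ if and only if $(x,g(y))\in R'$.
   Context: For finite sets $X,Y$ and a relation $R\subseteq X\times Y$, the Dowker complex $D(X,Y,R)$ is the abstract simplicial complex on the vertex set $X$ consisting of all subsets $\sigma\subseteq X$ for which there is a $y\in Y$ with $(x,y)\in R$ for all $x\in\sigma$. The empty simplex $\emptyset$ is included (whenever $Y\neq\emptyset$). The total weight of $R$ is the function $t:D(X,Y,R)\to\mathbb{N}$ given by $$t(\sigma)=\#\{y\in Y : (x,y)\in R \text{ for all } x\in\sigma\}.$$ *)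

(* Defs.v *)
From mathcomp Require Import all_boot.

Set Implicit Arguments.
Unset Strict Implicit.
Unset Printing Implicit Defensive.

(* For Y nonempty the empty simplex belongs to the complex; for Y empty the
   complex has no simplex at all. *)
Definition Dowker (X Y : finType) (R : {set X * Y}) : {set {set X}} :=
  [set sigma : {set X} | [exists y : Y, [forall x in sigma, (x, y) \in R]]].

(* The total weight is a function on the simplices of Dowker R; it is encoded
   as a function on all subsets of X, to be restricted to Dowker R where it is
   used. *)
Definition total_weight (X Y : finType) (R : {set X * Y}) (sigma : {set X}) :
    nat :=
  #|[set y : Y | [forall x in sigma, (x, y) \in R]]|.

(* Main.v *)
(* The relation is determined, up to a bijection on the second set, by the
   number of y whose neighbourhood {x | (x, y) in R} equals a given subset of X.
   The total weight counts the y whose neighbourhood contains a given subset, so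
   these numbers are recovered by descending induction on subsets. *)
Require Import Defs.
From mathcomp Require Import all_boot.

(** Enumerate every fibre and send the [i]-th element of a fibre of [f] to the [i]-th element of the
    fibre of [f'] over the same value; the inequality keeps [i] in range. *)
Lemma card_fiber_le_inj (T Y Y' : finType) (f : Y -> T) (f' : Y' -> T) :
  (forall t, #|[set y | f y == t]| <= #|[set y | f' y == t]|) ->
  exists2 g : Y -> Y', injective g & forall y, f' (g y) = f y.
Proof.
(* [nth] needs a default in [Y']; if [Y'] is empty, the inequality forces [Y] to be empty too. *)
move=> le_ff'; case: (pickP (@predT Y')) => [y0 _|Y'0]; last first.
  have noY (y : Y) : False.
    have := le_ff' (f y); rewrite (_ : [set y' | f' y' == f y] = set0).
      by rewrite cards0 leqn0 cards_eq0 => /eqP/setP/(_ y); rewrite !inE eqxx.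
    by apply/setP => y'; have := Y'0 y'.
  by exists (fun y => False_rect Y' (noY y)) => y; case: (noY y).
pose F t := enum [set y | f y == t]; pose F' t := enum [set y | f' y == t].
pose g y := nth y0 (F' (f y)) (index y (F (f y))).
have memF y : y \in F (f y) by rewrite mem_enum inE.
have ltF' y : index y (F (f y)) < size (F' (f y)).
  by rewrite (leq_trans _ (_ : size (F (f y)) <= _)) ?index_mem // -!cardE.
have f'g y : f' (g y) = f y.
  by have := mem_nth y0 (ltF' y); rewrite mem_enum inE => /eqP.
exists g => // y1 y2 eq_g.
(* Equal images come from one fibre, whose enumeration has no repetition, so the two indices
   agree. *)
have eq_f : f y1 = f y2 by rewrite -!f'g eq_g.
have := ltF' y1; have := memF y1; move/eqP: eq_g; rewrite /g eq_f => eq_g m1 lt1.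
rewrite nth_uniq ?enum_uniq // in eq_g.
by rewrite -(nth_index y1 m1) (eqP eq_g) nth_index.
Qed.

(** The injection in the other direction serves only to bound the cardinality of [Y'] by that of
    [Y]. *)
Lemma card_fiber_eq_bij (T Y Y' : finType) (f : Y -> T) (f' : Y' -> T) :
  (forall t, #|[set y | f y == t]| = #|[set y | f' y == t]|) ->
  exists2 g : Y -> Y', bijective g & forall y, f' (g y) = f y.
Proof.
move=> eq_ff'.
have [t|g inj_g f'g] := @card_fiber_le_inj _ _ _ f f'.
  by rewrite eq_ff'.
have [t|h inj_h _] := @card_fiber_le_inj _ _ _ f' f.
  by rewrite eq_ff'.
by exists g => //; apply: inj_card_bij (leq_card h inj_h).
Qed.

Lemma card_supset_fibers (X Y : finType) (f : Y -> {set X}) (s : {set X}) :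
  #|[set y | s \subset f y]| =
    #|[set y | f y == s]| + \sum_(t : {set X} | s \proper t) #|[set y | f y == t]|.
Proof.
rewrite -sum1_card (partition_big f (fun t : {set X} => s \subset t)) /=; last first.
  by move=> y; rewrite inE.
rewrite (bigD1 s) //=; congr (_ + _).
  rewrite -sum1_card; apply: eq_bigl => y; rewrite !inE.
  by case: eqP => [->|]; rewrite ?subxx ?andbF.
apply: eq_big => [t|t /andP[st _]]; first by rewrite properEneq eq_sym andbC.
rewrite -sum1_card; apply: eq_bigl => y; rewrite !inE.
by case: eqP => [->|]; rewrite ?st ?andbF.
Qed.

Lemma card_supset_eq_fiber (X Y Y' : finType) (f : Y -> {set X})
    (f' : Y' -> {set X}) :
  (forall s : {set X}, #|[set y | s \subset f y]| = #|[set y | s \subset f' y]|) ->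
  forall s, #|[set y | f y == s]| = #|[set y | f' y == s]|.
Proof.
(* Descending induction on [s], measured by the size of its complement: the sums over proper
   supersets agree and cancel. *)
move=> eq_sup s; have [n] := ubnP #|~: s|.
elim: n s => // n IHn s; rewrite ltnS => le_s_n.
have := eq_sup s; rewrite !card_supset_fibers.
rewrite (eq_bigr (fun t => #|[set y | f' y == t]|)) => [/addIn //|t st].
by apply: IHn; apply: leq_trans le_s_n; rewrite proper_card // properC.
Qed.

Definition neighbourhood {X Y : finType} (R : {set X * Y}) (y : Y) : {set X} :=
  [set x | (x, y) \in R].

Lemma sub_neighbourhood (X Y : finType) (R : {set X * Y}) (s : {set X}) y :
  [forall x in s, (x, y) \in R] = (s \subset neighbourhood R y).
Proof.
by apply/forall_inP/subsetP => sR x /sR; rewrite inE.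
Qed.

Lemma total_weightE (X Y : finType) (R : {set X * Y}) (s : {set X}) :
  total_weight R s = #|[set y | s \subset neighbourhood R y]|.
Proof. by apply: eq_card => y; rewrite !inE sub_neighbourhood. Qed.

Lemma total_weight_notin (X Y : finType) (R : {set X * Y}) (s : {set X}) :
  s \notin Dowker R -> total_weight R s = 0.
Proof.
rewrite inE negb_exists => /forallP noy; apply/eqP; rewrite cards_eq0.
by apply/eqP/setP => y; rewrite !inE (negbTE (noy y)).
Qed.

Theorem theorem2 (X Y Y' : finType) (R : {set X * Y}) (R' : {set X * Y'})
    (eqD : Dowker R = Dowker R')
    (eqt : {in Dowker R, total_weight R =1 total_weight R'}) :
  exists g : Y -> Y',
    bijective g /\
    forall (x : X) (y : Y), ((x, y) \in R) <-> ((x, g y) \in R').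
Proof.
have eq_sup (s : {set X}) : #|[set y | s \subset neighbourhood R y]|
              = #|[set y | s \subset neighbourhood R' y]|.
  (* Both weights vanish off the common complex, so their agreement extends to all subsets of
     [X]. *)
  rewrite -!total_weightE; have [/eqt //|sD] := boolP (s \in Dowker R).
  by rewrite !total_weight_notin -?eqD.
have [g bij_g Ng] :=
  card_fiber_eq_bij _ _ _ _ _ (card_supset_eq_fiber _ _ _ _ _ eq_sup).
exists g; split=> // x y.
by have /setP/(_ x) := Ng y; rewrite !inE => ->.
Qed.
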